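(* Let $\mathcal{R}$ be a commutative perfect cancellative semi-ring of characteristic $1$ satisfying the standing assumptions in the context, with semi-field of fractions $\mathcal{F}$. 1. Let $(r_j)_{j\in J}$ be a family of congruences on $\mathcal{F}$. Then $\displaystyle\bigcap_{j\in J}V(r_j)=V\Bigl(\bigvee_{j\in J}r_j\Bigr)$. 2. Let $(r_l)_{l\in L}$ be a finite family of congruences on $\mathcal{F}$. Then $\displaystyle\bigcup_{l\in L}V(r_l)=V\Bigl(\bigwedge_{l\in L}r_l\Bigr)$.
   Context: A commutative semi-ring of characteristic $1$ is a triple $(\mathcal{R},\oplus,+)$ with two associative laws such that: $(\mathcal{R},+)$ is an abelian monoid with identity $0$; $\oplus$ is commutative with $X\oplus X=X$; and $X+(Y\oplus Z)=(X+Y)\oplus(X+Z)$. It is cancellative if $X+Y=X+Z$ implies $Y=Z$, and perfect if for every integer $n\ge1$ the map $X\mapsto nX$ is surjective (in the cancellative case it is then bijective, which defines an action of the positive rationals). A cancellative $\mathcal{R}$ embeds in its semi-field of fractions $\mathcal{F}=\{X-Y: X,Y\in\mathcal{R}\}$, where $(\mathcal F,+)$ is the group of differences and $(A-B)\oplus(A'-B')=\bigl((A+B')\oplus(A'+B)\bigr)-(B+B')$. Partial order on $\mathcal{F}$: $X\le Y$ iff $X\oplus Y=Y$. Standing assumptions: (i) there is a fixed $E\in\mathcal{F}$ such that for every $X\in\mathcal{F}$ there is $t\in\mathbb{Q}^+$ with $-tE\le X\le tE$, and if the infimum of all such $t$ is $0$ then $X=0$; (ii) the action of the positive rationals on $\mathcal{R}$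 and $\mathcal{F}$ extends to an action of $(0,\infty)$ by automorphisms so that $\mathcal{F}$ becomes an $\mathbb{R}$-vector space; (iii) $tE\in\mathcal{R}$ for every real $t$. $S_E(\mathcal{F})$ is the set of maps $\phi:\mathcal{F}\to\mathbb{R}$ with $\phi(X\oplus Y)=\max(\phi(X),\phi(Y))$, $\phi(X+Y)=\phi(X)+\phi(Y)$, $\phi(E)=1$. A congruence on $\mathcal{F}$ is an equivalence relation $r$ such that $X\,r\,Y$ implies $(-X)\,r\,(-Y)$, $(X+Z)\,r\,(Y+Z)$ and $(X\oplus Z)\,r\,(Y\oplus Z)$ for all $Z$. For a congruence $r$, $V(r)$ is the set of $\phi\in S_E(\mathcal{F})$ such that $X\,r\,Y$ implies $\phi(X)=\phi(Y)$. $\bigvee_{j}r_j$ is the intersection of all congruences $r$ such that ($X\,r_j\,Y$ for some $j$) implies $X\,r\,Y$. $\bigwedge_jr_j$ is the congruence: $X(\bigwedge_jr_j)Y$ iff $X\,r_j\,Y$ for all $j$. *)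

(* Defs.v *)
From Corelib Require Import RelationClasses.
From HB Require Import structures.
From mathcomp Require Import all_boot all_order all_algebra.
From mathcomp Require Import all_classical all_reals.

Set Implicit Arguments.
Unset Strict Implicit.
Unset Printing Implicit Defensive.

Import Order.TTheory GRing.Theory Num.Theory.
Local Open Scope ring_scope.
Local Open Scope quotient_scope.
Local Open Scope classical_set_scope.

Declare Scope char1_scope.
Delimit Scope char1_scope with C1.

(* The multiplication of a semi-ring of characteristic 1 is written additively,
   so that the abelian monoid (R, +, 0) is the underlying nmodType, and the
   idempotent "addition" is oplus. *)
HB.mixin Record Nmodule_isChar1SemiRing V of GRing.Nmodule V := {
  oplus : V -> V -> V;
  oplusA : associative oplus;
  oplusC : commutative oplus;
  oplusxx : idempotent_op oplus;
  addr_oplusr : right_distributive (@GRing.add V) oplus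
}.

#[short(type="char1SemiRingType")]
HB.structure Definition Char1SemiRing :=
  {V of Nmodule_isChar1SemiRing V & GRing.Nmodule V}.

HB.mixin Record Char1SemiRing_isCancellative V of Char1SemiRing V := {
  cancel_addrI : right_injective (@GRing.add V)
}.

#[short(type="cancelChar1SemiRingType")]
HB.structure Definition CancelChar1SemiRing :=
  {V of Char1SemiRing_isCancellative V & Char1SemiRing V}.

Notation "X ⊕ Y" := (oplus X Y) (at level 50, left associativity) : char1_scope.
Local Open Scope char1_scope.

Definition le1 (V : char1SemiRingType) (X Y : V) : Prop := X ⊕ Y = Y.
Notation "X ≼ Y" := (le1 X Y) (at level 70, no associativity) : char1_scope.

Definition perfect (V : char1SemiRingType) : Prop :=
  forall n : nat, (1 <= n)%N -> forall Y : V, exists X : V, X *+ n = Y.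

(* The semi-field of fractions: pairs (A, B), standing for A - B, modulo
   (A, B) ~ (A', B') iff A + B' = A' + B. *)
Section Fractions.
Variable R : cancelChar1SemiRingType.
Implicit Types p q : R * R.

Definition sfrac_equiv p q : bool := p.1 + q.2 == q.1 + p.2.

Lemma sfrac_equiv_refl : reflexive sfrac_equiv.
Proof. by move=> p; rewrite /sfrac_equiv. Qed.

Lemma sfrac_equiv_sym : symmetric sfrac_equiv.
Proof. by move=> p q; rewrite /sfrac_equiv eq_sym. Qed.

Lemma sfrac_equiv_trans : transitive sfrac_equiv.
Proof.
move=> q p s /eqP pq /eqP qs; apply/eqP; apply: (@cancel_addrI _ q.2).
by rewrite addrA [q.2 + _]addrC pq addrAC qs addrCA addrA.
Qed.

Canonical sfrac_equiv_rel :=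
  EquivRel sfrac_equiv sfrac_equiv_refl sfrac_equiv_sym sfrac_equiv_trans.

Definition sfrac := {eq_quot sfrac_equiv}.
HB.instance Definition _ := Choice.on sfrac.
HB.instance Definition _ := EqQuotient.on sfrac.

Lemma sfracP p q : reflect (p.1 + q.2 = q.1 + p.2) (\pi_sfrac p == \pi_sfrac q).
Proof. by rewrite eqquotE; apply: eqP. Qed.

Definition pair_add p q : R * R := (p.1 + q.1, p.2 + q.2).
Definition pair_opp p : R * R := (p.2, p.1).
Definition pair_oplus p q : R * R := ((p.1 + q.2) ⊕ (q.1 + p.2), p.2 + q.2).

Definition sfrac_zero : sfrac := \pi_sfrac (0, 0).
Definition sfrac_add : sfrac -> sfrac -> sfrac := lift_op2 sfrac pair_add.
Definition sfrac_opp : sfrac -> sfrac := lift_op1 sfrac pair_opp.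
Definition sfrac_oplus : sfrac -> sfrac -> sfrac := lift_op2 sfrac pair_oplus.

Lemma sfrac_reprE p :
  p.1 + (repr (\pi_sfrac p)).2 = (repr (\pi_sfrac p)).1 + p.2.
Proof. by apply/sfracP; rewrite reprK. Qed.

Lemma addr_oplusl (X Y Z : R) : (X ⊕ Y) + Z = (X + Z) ⊕ (Y + Z).
Proof. by rewrite addrC addr_oplusr !(addrC Z). Qed.

Lemma pi_sfrac_add : {morph \pi_sfrac : p q / pair_add p q >-> sfrac_add p q}.
Proof.
move=> p q; unlock sfrac_add; apply/eqP/sfracP => /=.
by rewrite addrACA !sfrac_reprE addrACA.
Qed.
Canonical pi_sfrac_add_morph := PiMorph2 pi_sfrac_add.

Lemma pi_sfrac_opp : {morph \pi_sfrac : p / pair_opp p >-> sfrac_opp p}.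
Proof.
move=> p; unlock sfrac_opp; apply/eqP/sfracP => /=.
by rewrite addrC -sfrac_reprE addrC.
Qed.
Canonical pi_sfrac_opp_morph := PiMorph1 pi_sfrac_opp.

Lemma pi_sfrac_oplus :
  {morph \pi_sfrac : p q / pair_oplus p q >-> sfrac_oplus p q}.
Proof.
move=> p q; unlock sfrac_oplus; apply/eqP/sfracP => /=.
have := sfrac_reprE p; have := sfrac_reprE q.
move: (repr _) (repr _) => p' q' /= eq ep; rewrite !addr_oplusl; congr (_ ⊕ _).
  by rewrite addrACA ep [q.2 + _]addrC addrACA.
by rewrite [p'.2 + _]addrC addrACA eq addrACA [q.2 + _]addrC addrACA.
Qed.
Canonical pi_sfrac_oplus_morph := PiMorph2 pi_sfrac_oplus.

Lemma sfrac_addA : associative sfrac_add.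
Proof.
elim/quotW=> p; elim/quotW=> q; elim/quotW=> s.
by rewrite !piE /pair_add !addrA.
Qed.

Lemma sfrac_addC : commutative sfrac_add.
Proof.
by elim/quotW=> p; elim/quotW=> q; rewrite !piE /pair_add addrC [q.2 + _]addrC.
Qed.

Lemma sfrac_add0 : left_id sfrac_zero sfrac_add.
Proof.
by elim/quotW=> -[a b]; rewrite /sfrac_zero !piE /pair_add /= !add0r.
Qed.

Lemma sfrac_addN : left_inverse sfrac_zero sfrac_opp sfrac_add.
Proof.
elim/quotW=> p; rewrite /sfrac_zero !piE /pair_add /pair_opp /=.
by apply/eqP/sfracP; rewrite /= addr0 add0r addrC.
Qed.

HB.instance Definition _ :=
  GRing.isZmodule.Build sfrac sfrac_addA sfrac_addC sfrac_add0 sfrac_addN.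

Lemma sfrac_oplusA : associative sfrac_oplus.
Proof.
elim/quotW=> p; elim/quotW=> q; elim/quotW=> s; rewrite !piE /pair_oplus /=.
congr (\pi _); rewrite !addr_oplusl addrA oplusA; congr (_ ⊕ _ ⊕ _, _).
- by rewrite addrAC.
- by rewrite -addrA [q.2 + _]addrC.
- by rewrite addrA.
Qed.

Lemma sfrac_oplusC : commutative sfrac_oplus.
Proof.
elim/quotW=> p; elim/quotW=> q; rewrite !piE /pair_oplus.
by rewrite oplusC [p.2 + _]addrC.
Qed.

Lemma sfrac_oplusxx : idempotent_op sfrac_oplus.
Proof.
elim/quotW=> p; rewrite !piE /pair_oplus oplusxx.
by apply/eqP/sfracP; rewrite /= addrAC addrA.
Qed.

Lemma sfrac_addr_oplusr : right_distributive (@GRing.add sfrac) sfrac_oplus.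
Proof.
elim/quotW=> p; elim/quotW=> q; elim/quotW=> s.
rewrite /GRing.add /= !piE /pair_oplus /pair_add /=.
apply/eqP/sfracP; rewrite /= addr_oplusr !addr_oplusl.
congr (_ ⊕ _).
- by rewrite !addrA [_ + s.2 + p.2]addrAC [_ + q.2 + p.2]addrAC.
- by rewrite !addrA; congr (_ + _); rewrite addrAC [_ + q.2 + p.2]addrAC.
Qed.

HB.instance Definition _ := Nmodule_isChar1SemiRing.Build sfrac
  sfrac_oplusA sfrac_oplusC sfrac_oplusxx sfrac_addr_oplusr.

Definition to_sfrac (X : R) : sfrac := \pi_sfrac (X, 0).

Lemma sfrac_oplusE (A B A' B' : R) :
  (to_sfrac A - to_sfrac B) ⊕ (to_sfrac A' - to_sfrac B') =
  to_sfrac ((A + B') ⊕ (A' + B)) - to_sfrac (B + B').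
Proof.
have subE X Y : to_sfrac X - to_sfrac Y = \pi_sfrac (X, Y).
  rewrite /to_sfrac /GRing.opp /= /GRing.add /= !piE.
  by rewrite /pair_add /pair_opp /= addr0 add0r.
by rewrite !subE /oplus /= !piE.
Qed.

Lemma to_sfrac_inj : injective to_sfrac.
Proof.
by move=> X Y /eqP/sfracP /=; rewrite !addr0.
Qed.

End Fractions.

Section StandingAssumptions.
Variables (K : realType) (R : cancelChar1SemiRingType).
Local Notation F := (sfrac R).

(* [scale] makes F a K-vector space in which every t > 0 acts by automorphisms
   of F and of R.  For t = m / n the element t X is the unique Y with
   n Y = m X, which is the action of the positive rationals. *)
Record real_action (scale : K -> F -> F) : Prop := RealAction {
  ractA : forall (s t : K) (X : F), scale s (scale t X) = scale (s * t) X;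
  ract1 : forall X : F, scale 1 X = X;
  ractDr : forall (t : K) (X Y : F), scale t (X + Y) = scale t X + scale t Y;
  ractDl : forall (s t : K) (X : F), scale (s + t) X = scale s X + scale t X;
  ract_rat : forall (m n : nat) (X Y : F), (0 < m)%N -> (0 < n)%N ->
    Y *+ n = X *+ m -> scale (m%:R / n%:R) X = Y;
  ract_oplus : forall (t : K) (X Y : F), 0 < t ->
    scale t (X ⊕ Y) = scale t X ⊕ scale t Y;
  (* with ractA, t^-1 provides the inverse of the restriction to R *)
  ract_to_sfrac : forall (t : K) (X : R), 0 < t ->
    exists Y : R, scale t (to_sfrac X) = to_sfrac Y
}.

(* The set of those t in K that are positive rationals with -tE <= X <= tE. *)
Definition rat_bounds (scale : K -> F -> F) (E X : F) : set K :=
  [set ratr q | q in [set q : rat |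
    [/\ 0 < q, - scale (ratr q) E ≼ X & X ≼ scale (ratr q) E]]].

Record standing_assumptions (scale : K -> F -> F) (E : F) : Prop :=
  StandingAssumptions {
    sa_bounded : forall X : F, rat_bounds scale E X !=set0;
    sa_separated : forall X : F, inf (rat_bounds scale E X) = 0 -> X = 0;
    sa_action : real_action scale;
    sa_unit : forall t : K, exists Y : R, scale t E = to_sfrac Y
  }.

End StandingAssumptions.

(* S_E(F) is a type of its own, so that sets of characters are subsets of it and
   the intersection of an empty family of them is S_E(F). *)
Record spectrum (K : realType) (R : cancelChar1SemiRingType) (E : sfrac R) :=
  Spectrum {
    spec_fun :> sfrac R -> K;
    spec_oplus : forall X Y : sfrac R,
      spec_fun (X ⊕ Y) = Num.max (spec_fun X) (spec_fun Y);
    spec_add : forall X Y : sfrac R,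
      spec_fun (X + Y) = spec_fun X + spec_fun Y;
    spec_unit : spec_fun E = 1
  }.

Section Congruences.
Variable R : cancelChar1SemiRingType.
Local Notation F := (sfrac R).

Record congruence := Congruence {
  cong_rel :> F -> F -> Prop;
  cong_equiv : Equivalence cong_rel;
  cong_opp : forall X Y : F, cong_rel X Y -> cong_rel (- X) (- Y);
  cong_add : forall X Y : F, cong_rel X Y ->
    forall Z : F, cong_rel (X + Z) (Y + Z);
  cong_oplus : forall X Y : F, cong_rel X Y ->
    forall Z : F, cong_rel (X ⊕ Z) (Y ⊕ Z)
}.

Section Meet.
Variables (I : Type) (r : I -> congruence).

Definition meet_rel (X Y : F) : Prop := forall i, r i X Y.

Lemma meet_equiv : Equivalence meet_rel.
Proof.
split.
- by move=> X i; have [+ _ _] := cong_equiv (r i); apply.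
- by move=> X Y XY i; have [_ + _] := cong_equiv (r i); apply; apply: XY.
- move=> X Y Z XY YZ i; have [_ _ +] := cong_equiv (r i).
  by apply; [apply: XY | apply: YZ].
Qed.

Lemma meet_opp X Y : meet_rel X Y -> meet_rel (- X) (- Y).
Proof. by move=> XY i; apply: cong_opp. Qed.

Lemma meet_add X Y : meet_rel X Y -> forall Z, meet_rel (X + Z) (Y + Z).
Proof. by move=> XY Z i; apply: cong_add. Qed.

Lemma meet_oplus X Y : meet_rel X Y -> forall Z, meet_rel (X ⊕ Z) (Y ⊕ Z).
Proof. by move=> XY Z i; apply: cong_oplus. Qed.

Definition cong_meet : congruence :=
  Congruence meet_equiv meet_opp meet_add meet_oplus.

End Meet.

Definition cong_join (J : Type) (r : J -> congruence) : congruence :=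
  cong_meet (fun c : {c : congruence |
    forall X Y : F, (exists j, r j X Y) -> c X Y} => sval c).

Definition congV (K : realType) (E : F) (r : congruence) :
    set (spectrum K E) :=
  [set phi | forall X Y : F, r X Y -> phi X = phi Y].

End Congruences.

Arguments congV {R} K E r.

(* Main.v *)
(* For part 2, let φ lie in no V(r_l). Each r_l then identifies 0 with some A_l
   such that φ(A_l) > 0, hence also with N_l := -(A_l ⊕ 0), where N_l ≼ 0 and
   φ(N_l) < 0. The sum N := ⨁_l N_l (with -(E ⊕ 0) thrown in, in case L is empty)
   satisfies φ(N) < 0, because φ turns ⊕ into max; since all summands are ≼ 0,
   replacing a single one of them by 0 turns the sum into 0, so N r_l 0 for every
   l, and φ is not in V(⋀ r_l). *)
Require Import Defs.
From mathcomp Require Import all_boot all_order all_algebra.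
From mathcomp Require Import all_classical all_reals.

Local Open Scope classical_set_scope.

Import Order.TTheory GRing.Theory Num.Theory.
Local Open Scope ring_scope.
Local Open Scope char1_scope.

(** Translating by [A ⊕ 0] reduces the claim to [0 ≼ A ⊕ 0], which is idempotency. *)
Lemma le1_opp_oplus0 (R : cancelChar1SemiRingType) (A : sfrac R) :
  - (A ⊕ 0) ≼ 0.
Proof.
apply: (addrI (A ⊕ 0)); rewrite addr_oplusr subrr addr0.
by rewrite oplusC -oplusA oplusxx.
Qed.

Section Characters.
Context {K : realType} {R : cancelChar1SemiRingType} {E : sfrac R}.
Implicit Types (phi : spectrum K E) (r : congruence R).

Lemma spec0 phi : phi 0 = 0.
Proof. by apply: (addrI (phi 0)); rewrite -spec_add !addr0. Qed.

Lemma specN phi X : phi (- X) = - phi X.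
Proof. by apply: (addrI (phi X)); rewrite -spec_add !subrr spec0. Qed.

Lemma spec_opp_oplus0_lt0 phi A : 0 < phi A -> phi (- (A ⊕ 0)) < 0.
Proof. by move=> A_gt0; rewrite specN oppr_lt0 spec_oplus lt_max A_gt0. Qed.

Lemma spec_ker_equiv phi : RelationClasses.Equivalence (fun X Y => phi X = phi Y).
Proof. by split=> // X Y Z ->. Qed.

(** The largest congruence whose [congV] contains [phi]; it serves as an upper bound of the family
    in part 1. *)
Definition spec_ker phi : congruence R.
Proof.
apply: (@Congruence R _ (spec_ker_equiv phi)) => X Y eqXY.
- by rewrite !specN eqXY.
- by move=> Z; rewrite !spec_add eqXY.
- by move=> Z; rewrite !spec_oplus eqXY.
Defined.

Lemma bigcap_congV (J : Type) (r : J -> congruence R) :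
  \bigcap_(j in [set: J]) congV K E (r j) = congV K E (cong_join r).
Proof.
apply/seteqP; split=> phi Vphi.
  move=> X Y; pose above (c : congruence R) :=
    forall X Y, (exists j, r j X Y) -> c X Y.
  have ker_above : above (spec_ker phi) by move=> A B [j]; apply: Vphi.
  (* The join is an intersection over a set of congruences that includes the kernel of [phi], so it
     is contained in that kernel. *)
  by move=> /(_ (exist above _ ker_above)).
by move=> j _ X Y rXY; apply: Vphi => -[c /= cr]; apply: cr; exists j.
Qed.

Lemma notin_congV phi r :
  ~ congV K E r phi -> exists2 N, r N 0 & N ≼ 0 /\ phi N < 0.
Proof.
have [r_refl r_sym _] := cong_equiv r.
suff from_pos A : r A 0 -> 0 < phi A ->
    exists2 N, r N 0 & N ≼ 0 /\ phi N < 0.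
  (* A pair [X], [Y] related by [r] but separated by [phi] yields [A]: whichever of [Y - X] and
     [X - Y] has positive value. *)
  move=> /existsNP[X /existsNP[Y /not_implyP[rXY /eqP]]].
  have sub0 B C : r B C -> r (B - C) 0.
    by move=> /cong_add /(_ (- C)); rewrite subrr.
  by case: ltgtP => // lt_phi _; [apply: (from_pos (Y - X)) |
       apply: (from_pos (X - Y))]; rewrite ?spec_add ?specN ?subr_gt0 //;
     apply: sub0 => //; apply: r_sym.
move=> rA A_gt0; exists (- (A ⊕ 0)).
  by have := cong_opp (cong_oplus rA 0); rewrite oplusxx oppr0.
by split; [exact: le1_opp_oplus0 | exact: spec_opp_oplus0_lt0].
Qed.

Lemma bigcup_congV (L : finType) (r : L -> congruence R) :
  \bigcup_(l in [set: L]) congV K E (r l) = congV K E (cong_meet r).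
Proof.
apply/seteqP; split=> phi.
  by case=> l _ Vphi X Y rXY; apply: Vphi; apply: rXY.
move=> Vphi; apply: contrapT => notV.
suff [N [_ N_lt0 rN]] : exists N,
    [/\ N ≼ 0, phi N < 0 & {in enum L, forall l, r l N 0}].
  have: phi N = phi 0 by apply: Vphi => l; apply: rN; rewrite mem_enum.
  by rewrite spec0 => N0; rewrite N0 ltxx in N_lt0.
elim: (enum L) => [|l s [N [N_le0 N_lt0 rN]]].
  exists (- (E ⊕ 0)); split=> //; first exact: le1_opp_oplus0.
  by apply: spec_opp_oplus0_lt0; rewrite spec_unit.
have [|M rM [M_le0 M_lt0]] := @notin_congV phi (r l).
  by move=> Vl; apply: notV; exists l.
exists (M ⊕ N); split.
- by rewrite /le1 -oplusA N_le0.
- by rewrite spec_oplus gt_max M_lt0.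
- move=> k; rewrite inE => /predU1P[->|/rN rkN].
    (* For the new index [M] is replaced by 0, and [0 ⊕ N = 0]; for an earlier index [N] is replaced
       instead. *)
    by have := cong_oplus rM N; rewrite [0 ⊕ N]oplusC N_le0.
  by have := cong_oplus rkN M; rewrite oplusC [0 ⊕ M]oplusC M_le0.
Qed.

End Characters.

Theorem proposition13 (K : realType) (R : cancelChar1SemiRingType)
    (scale : K -> sfrac R -> sfrac R) (E : sfrac R)
    (R_perfect : perfect R) (std : standing_assumptions scale E) :
  (forall (J : Type) (r : J -> congruence R),
     \bigcap_(j in [set: J]) congV K E (r j) = congV K E (cong_join r)) /\
  (forall (L : finType) (r : L -> congruence R),
     \bigcup_(l in [set: L]) congV K E (r l) = congV K E (cong_meet r)).
Proof. by split=> ? ?; [exact: bigcap_congV | exact: bigcup_congV]. Qed.
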